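(* Let $\epsilon\neq0$ be a constant (possibly complex) and consider the point transformation $$x'=e^{t+\frac v2},\qquad t'=t,\qquad u'=\frac{4\epsilon e^{-(v+2t)}}{ux^2},\qquad v'=2(\epsilon\ln x-t).$$ Applying it $2N$ times gives $$x^{(2N)}=x^{\epsilon^N},\qquad t^{(2N)}=t,\qquad u^{(2N)}=u\,x^{2(1-\epsilon^N)},\qquad v^{(2N)}=\epsilon^Nv+2(\epsilon^N-1)t .$$ Therefore the transformation forms a cyclic group of order $2N$ if $\epsilon$ is a root of the equation $\epsilon^N=1$. The only two real roots are $\epsilon=1$ and $\epsilon=-1$, and in these cases the transformation forms a cyclic group of order 2 and of order 4, respectively. If $\epsilon$ is allowed to be complex, then cyclic groups of any even order may be constructed; for example, for $\epsilon=\mathrm i$ the point transformation $x'=e^{t+v/2}$, $t'=t$, $u'=\frac{4\mathrm i}{ux^2\exp(v+2t)}$, $v'=2(\mathrm i\ln x-t)$ forms a cyclic group of order 8.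
   Context: The transformation acts on the variables $(x,t,u,v)$, and the superscript $(2N)$ denotes the variables obtained after $2N$ successive applications, $N$ being a positive integer. $\mathrm i$ is the imaginary unit. Point transformations are assumed non-degenerate.
   Formalization: Order exactly 2N is stated when N is the least exponent with ε^N=1 (ε=1, N=2 gives order 2); otherwise the order divides 2N. The root −1 is for even N only. For complex ε, x lies on the Riemann surface of ln, since ln(e^w)=w fails on C. *)

(* Defs.v *)
From HB Require Import structures.
From mathcomp Require Export all_boot all_order all_algebra.
From mathcomp Require Export complex.
From mathcomp Require Export all_classical all_reals all_analysis.
Set Implicit Arguments.
Unset Strict Implicit.
Unset Printing Implicit Defensive.
Export Order.TTheory GRing.Theory Num.Theory.
Export numFieldNormedType.Exports.
Global Open Scope classical_set_scope.
Global Open Scope ring_scope.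
Global Open Scope complex_scope.

Definition transformation_group (P : Type) (G : set (P -> P)) : Prop :=
  [/\ G id,
      forall f g, G f -> G g -> G (f \o g)
    & forall f, G f -> exists g, [/\ G g, f \o g = id & g \o f = id]].

Definition iterates (P : Type) (T : P -> P) : set (P -> P) :=
  range (fun k : nat => iter k T).

(* The group is cyclic by construction: its elements are powers of [T]. *)
Definition forms_cyclic_group (P : Type) (T : P -> P) (n : nat) : Prop :=
  transformation_group (iterates T) /\ (iterates T #= `I_n)%card.

(* [x > 0] is the domain of [ln x]; [u != 0] is the domain of [1 / u]. *)
Record rpoint (R : realType) := RPoint {
  rx : R; rt : R; ru : R; rv : R;
  rx_gt0 : 0 < rx;
  ru_neq0 : ru != 0 }.

Section RealTransformation.
Variables (R : realType) (eps : R) (eps_neq0 : eps != 0).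
Implicit Type p : rpoint R.

Definition rnew_u p : R :=
  4 * eps * expR (- (rv p + 2 * rt p)) / (ru p * rx p ^+ 2).

Lemma rnew_u_neq0 p : rnew_u p != 0.
Proof.
have x0 : rx p != 0 by rewrite gt_eqF ?rx_gt0.
have e0 : expR (- (rv p + 2 * rt p)) != 0 by rewrite gt_eqF ?expR_gt0.
by rewrite /rnew_u !(mulf_eq0, invr_eq0, expf_eq0) /= !negb_or
  pnatr_eq0 eps_neq0 e0 ru_neq0 x0.
Qed.

Definition rtransf p : rpoint R :=
  RPoint (rt p) (2 * (eps * ln (rx p) - rt p))
    (expR_gt0 (rt p + rv p / 2)) (rnew_u_neq0 p).

End RealTransformation.

Definition cexp (R : realType) (z : R[i]) : R[i] :=
  (expR (complex.Re z))%:C * (cos (complex.Im z) +i* sin (complex.Im z)).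

Lemma cexp_neq0 (R : realType) (z : R[i]) : cexp z != 0.
Proof.
rewrite /cexp mulf_eq0 negb_or !eq_complex /= eqxx andbT gt_eqF ?expR_gt0 //=.
apply/negP => /andP[/eqP c0 /eqP s0].
have := cos2Dsin2 (complex.Im z).
by rewrite c0 s0 expr0n addr0 => /eqP; rewrite eq_sym oner_eq0.
Qed.

(* The Riemann surface of the logarithm: the graph of [cexp], i.e. nonzero
   complex numbers [lval] together with one of their logarithms [lln].  On it
   the logarithm is a single-valued function, inverse to the exponential, as
   the composition of transformations involving [ln x] requires; for the
   principal logarithm on [C], ln (e^w) = w fails in general. *)
Record logsurf (R : realType) := LogSurf {
  lval : R[i];
  lln : R[i];
  lvalE : lval == cexp lln }.

(* The exponential, as a map to the surface. *)
Definition lexp (R : realType) (w : R[i]) : logsurf R := LogSurf (eqxx (cexp w)).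

(* Complex powers: x^a = e^(a ln x). *)
Definition lpow (R : realType) (x : logsurf R) (a : R[i]) : logsurf R :=
  lexp (a * lln x).

Lemma lval_neq0 (R : realType) (x : logsurf R) : lval x != 0.
Proof. by rewrite (eqP (lvalE x)) cexp_neq0. Qed.

Record cpoint (R : realType) := CPoint {
  cx : logsurf R; ct : R[i]; cu : R[i]; cv : R[i];
  cu_neq0 : cu != 0 }.

Section ComplexTransformation.
Variables (R : realType) (eps : R[i]) (eps_neq0 : eps != 0).
Implicit Type p : cpoint R.

Definition cnew_u p : R[i] :=
  4 * eps * cexp (- (cv p + 2 * ct p)) / (cu p * lval (cx p) ^+ 2).

Lemma cnew_u_neq0 p : cnew_u p != 0.
Proof.
apply: mulf_neq0; last first.
  by rewrite invr_eq0 mulf_neq0 ?cu_neq0 // expf_neq0 ?lval_neq0.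
apply: mulf_neq0; last exact: cexp_neq0.
by apply: mulf_neq0 => //; rewrite pnatr_eq0.
Qed.

Definition ctransf p : cpoint R :=
  CPoint (lexp (ct p + cv p / 2)) (ct p)
    (2 * (eps * lln (cx p) - ct p)) (cnew_u_neq0 p).

End ComplexTransformation.

Lemma i_neq0 (R : realType) : ('i%C : R[i]) != 0.
Proof. by rewrite eq_complex /= oner_eq0 andbF. Qed.

(* Main.v *)
Require Import Defs.
From mathcomp Require Import ring cyclic separable cyclotomic.

Set Implicit Arguments.
Unset Strict Implicit.
Unset Printing Implicit Defensive.

(** In the coordinates [l = ln x], [t], [u], [v] the transformation is affine
    on [(l, t, v)]: [l' = t + v / 2], [t' = t], [v' = 2 (eps l - t)].  It
    exchanges the roles of [l] and of [w = t + v / 2]: [l' = w] and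
    [w' = eps l].  Hence its square multiplies both [l] and [w] by [eps],
    while the factors [4 eps] and [e^(v + 2 t)] cancel in [u''], leaving
    [u'' = u e^(2 (1 - eps) l)].  Induction on [N] gives the iterate of order
    [2 N] ([chart_iter_even]).

    An even iterate [2 k] is the identity if and only if [eps ^ k = 1]: the
    condition is necessary at any point with [l != 0].  An odd iterate is never
    the identity, since its [l] is a multiple of [w], which is independent of
    [l] ([chart_iter_odd_neq_id]).  So if [eps] is a primitive [N]-th root of
    unity then [2 N] is the least positive period of the transformation, and
    its iterates form a group with [2 N] elements ([forms_cyclic_group_period]).
    Any root of [eps ^ N = 1] is primitive of some order dividing [N].

    The argument is the same over the reals and over the complex numbers; it is
    carried out once for an abstract logarithmic chart ([log_chart]), which both
    transformations admit.  On the Riemann surface of the logarithm [ln x] is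
    single-valued, so the complex case has no branch ambiguity. *)

(** * Cyclic groups of iterates *)

Lemma iter_modn (P : Type) (T : P -> P) (n k : nat) :
  iter n T =1 id -> iter k T =1 iter (k %% n) T.
Proof.
move=> Tn p; rewrite {1}(divn_eq k n) addnC iterD; congr iter.
by elim: (k %/ n)%N => //= q IHq; rewrite mulSn iterD IHq Tn.
Qed.

(** If [iter i T] and [iter j T] agreed for [i < j < n], composing both with
    [iter (n - j) T] would make [n - j + i], which lies strictly between [0] and
    [n], a period; so the [n] first iterates are distinct. *)
Lemma forms_cyclic_group_period (P : Type) (T : P -> P) (n : nat) :
    (0 < n)%N -> iter n T =1 id ->
    (forall k, (0 < k < n)%N -> ~ iter k T =1 id) ->
  forms_cyclic_group T n.
Proof.
move=> n0 Tn Tk; split.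
  split; first by exists 0%N.
    by move=> _ _ [j _ <-] [k _ <-]; exists (j + k)%N => //;
      apply/funext => p; rewrite iterD.
  move=> _ [k _ <-]; exists (iter (n - k %% n) T).
  have kn : (k %% n <= n)%N by rewrite ltnW // ltn_mod.
  split; first by exists (n - k %% n)%N.
    by apply/funext => p /=; rewrite (iter_modn _ Tn) -iterD subnKC.
  by apply/funext => p /=; rewrite (iter_modn k Tn) -iterD subnK.
have -> : iterates T = (fun k => iter k T) @` `I_n.
  apply/seteqP; split=> _ [k kn <-]; last by exists k.
  exists (k %% n)%N; first by rewrite /= ltn_mod.
  by apply/funext => p; rewrite [RHS](iter_modn k Tn).
apply: inj_card_eq => i j.
wlog ij : i j / (i <= j)%N.
  by case/orP: (leq_total i j) => ij H iI jI Tij; [|symmetry]; apply: H.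
rewrite !inE /= => iI jI Tij; apply/eqP; rewrite eqn_leq ij leqNgt /=.
apply/negP => ltij; apply: (Tk (n - j + i)%N).
  by rewrite addn_gt0 subn_gt0 jI /= -ltn_subRL subKn // ltnW.
by move=> p; rewrite iterD (congr1 (@^~ p) Tij) -iterD subnK ?Tn // ltnW.
Qed.

(** * The transformation in a logarithmic chart *)

(** [E] plays the part of the exponential, and [l] that of [ln x].  The last two
    fields say that the coordinates separate points, and that [l], [t] and [v]
    take all values independently. *)
Record log_chart (K : numFieldType) (P : Type) (E : K -> K) (eps : K)
    (T : P -> P) (l t u v : P -> K) : Prop := LogChart {
  chart_exp0 : E 0 = 1;
  chart_expD : forall a b, E (a + b) = E a * E b;
  chart_u_neq0 : forall p, u p != 0;
  chart_l : forall p, l (T p) = t p + v p / 2;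
  chart_t : forall p, t (T p) = t p;
  chart_u : forall p,
    u (T p) = 4 * eps * E (- (v p + 2 * t p)) / (u p * E (l p) ^+ 2);
  chart_v : forall p, v (T p) = 2 * (eps * l p - t p);
  chart_inj : forall p q, l p = l q -> t p = t q -> u p = u q -> v p = v q ->
    p = q;
  chart_surj : forall a b c, exists p, [/\ l p = a, t p = b & v p = c] }.

Section LogChartTheory.
Variables (K : numFieldType) (P : Type) (E : K -> K) (eps : K) (T : P -> P).
Variables (l t u v : P -> K).
Hypothesis chart : log_chart E eps T l t u v.
Hypothesis eps_neq0 : eps != 0.

Lemma chart_exp_neq0 a : E a != 0.
Proof.
apply/eqP => E0; have := chart_expD chart a (- a).
by rewrite subrr (chart_exp0 chart) E0 mul0r => /eqP; rewrite oner_eq0.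
Qed.

Lemma chart_expN a : E (- a) = (E a)^-1.
Proof.
apply: (mulfI (chart_exp_neq0 a)).
by rewrite -(chart_expD chart) subrr (chart_exp0 chart) mulfV ?chart_exp_neq0.
Qed.

Lemma chart_iter2 p (q := T (T p)) :
  [/\ l q = eps * l p, t q = t p, u q = u p * E (2 * (1 - eps) * l p)
    & v q = eps * v p + 2 * (eps - 1) * t p].
Proof.
have two0 : (2 : K) != 0 by rewrite pnatr_eq0.
rewrite {}/q; split.
- by rewrite !(chart_l chart, chart_v chart, chart_t chart); field.
- by rewrite !(chart_t chart).
- rewrite !(chart_u chart, chart_l chart, chart_v chart, chart_t chart).
  have expX2 a : E a ^+ 2 = E (2 * a).
    by rewrite mulr2n mulrDl mul1r (chart_expD chart).
  have -> : 2 * (eps * l p - t p) + 2 * t p = eps * (2 * l p) by ring.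
  have -> : 2 * (1 - eps) * l p = 2 * l p - eps * (2 * l p) by ring.
  have -> : - (v p + 2 * t p) = - (2 * (t p + v p / 2)) by field.
  rewrite !(expX2, chart_expD chart (2 * l p), chart_expN).
  by field; rewrite !chart_exp_neq0 (chart_u_neq0 chart) eps_neq0.
- by rewrite !(chart_v chart, chart_l chart, chart_t chart); field.
Qed.

Lemma chart_iter_even N p (q := iter (2 * N) T p) :
  [/\ l q = eps ^+ N * l p, t q = t p,
      u q = u p * E (2 * (1 - eps ^+ N) * l p)
    & v q = eps ^+ N * v p + 2 * (eps ^+ N - 1) * t p].
Proof.
rewrite {}/q; elim: N => [|N [IHl IHt IHu IHv]].
  by rewrite muln0 expr0 subrr mulr0 !mul0r !mul1r (chart_exp0 chart) mulr1 addr0.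
rewrite mulnS add2n !iterS.
have [-> -> -> ->] := chart_iter2 (iter (2 * N) T p).
rewrite IHl IHt IHu IHv exprS; split=> //; [by rewrite mulrA | | by ring].
by rewrite -[LHS]mulrA -(chart_expD chart); congr (_ * E _); ring.
Qed.

Lemma chart_iter_even_id N : iter (2 * N) T =1 id <-> eps ^+ N = 1.
Proof.
split=> [TN | eN p].
  have [p [lp _ _]] := chart_surj chart 1 0 0.
  by have [] := chart_iter_even N p; rewrite TN lp mulr1 => <-.
have [] := chart_iter_even N p.
rewrite eN subrr mulr0 !mul0r !mul1r (chart_exp0 chart) mulr1 addr0.
exact: (chart_inj chart).
Qed.

(** At a point with [t = v = 0] every odd iterate has [l = 0]. *)
Lemma chart_iter_odd_neq_id k : odd k -> ~ iter k T =1 id.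
Proof.
move=> k_odd Tk; have [p [lp tp vp]] := chart_surj chart 1 0 0.
have := congr1 l (Tk p).
rewrite -(odd_double_half k) k_odd add1n -mul2n iterS (chart_l chart).
have [_ -> _ ->] := chart_iter_even k./2 p.
by rewrite lp tp vp !mulr0 addr0 mul0r addr0 => /eqP; rewrite eq_sym oner_eq0.
Qed.

Lemma chart_cyclic_prim N :
  N.-primitive_root eps -> forms_cyclic_group T (2 * N).
Proof.
move=> primN; have N0 := prim_order_gt0 primN.
apply: forms_cyclic_group_period; first by rewrite muln_gt0.
  exact/chart_iter_even_id/prim_expr_order.
move=> k /andP[k0 kN] Tk; case: (boolP (odd k)) => [/chart_iter_odd_neq_id //|].
move=> k_even; move: k0 kN Tk; rewrite -(odd_double_half k) (negbTE k_even).
rewrite add0n -mul2n muln_gt0 /= ltn_mul2l /= => k0 kN /chart_iter_even_id /eqP.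
by rewrite -(prim_order_dvd primN) gtnNdvd.
Qed.

Lemma chart_cyclic_dvdn N : (0 < N)%N -> eps ^+ N = 1 ->
  iter (2 * N) T =1 id /\
  exists2 m : nat, (m %| 2 * N)%N & forms_cyclic_group T m.
Proof.
move=> N0 eN; split; first exact/chart_iter_even_id.
have [m primm mN] := prim_order_exists N0 eN.
by exists (2 * m)%N; [rewrite dvdn_pmul2l | exact: chart_cyclic_prim].
Qed.

End LogChartTheory.

(** * Roots of unity *)

Lemma prim_root1 (K : nzRingType) : 1.-primitive_root (1 : K).
Proof.
apply/andP; split=> //; apply/forallP => i.
by rewrite ord1 unity_rootE expr1 eqxx.
Qed.

Lemma prim_rootN1 (K : numDomainType) : 2.-primitive_root (-1 : K).
Proof.
have [//||m primm] := @prim_order_exists K 2 (-1).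
  by rewrite sqrrN expr1n.
move: (prim_expr_order primm); case: m primm => [|[|[|m]]] // _.
by rewrite expr1 => /eqP; rewrite lt_eqF // (lt_trans _ ltr01) // oppr_lt0.
Qed.

Lemma prim_root_imaginary (R : rcfType) : 4.-primitive_root ('i%C : R[i]).
Proof.
have i4 : ('i%C : R[i]) ^+ 4 = 1 by rewrite (exprM _ 2 2) sqr_i sqrrN expr1n.
have [//|m primm] := prim_order_exists _ i4.
have i2 : ~~ (m %| 2)%N.
  rewrite (prim_order_dvd primm) sqr_i.
  by rewrite lt_eqF // (lt_trans _ ltr01) // oppr_lt0.
by case: m primm i2 => [|[|[|[|[|m]]]]].
Qed.

(** ['X^n - 1] is separable, so it has [n] distinct roots, and a field has a
    primitive root among any [n] distinct [n]-th roots of unity. *)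
Lemma closed_field_prim_root (F : closedFieldType) (n : nat) :
  n%:R != 0 :> F -> exists z : F, n.-primitive_root z.
Proof.
move=> nF; have n0 : (0 < n)%N by case: n nF => //; rewrite eqxx.
have [r] := closed_field_poly_normal ('X^n - 1 : {poly F}).
rewrite (monicP (monic_Xn_sub_1 F n0)) scale1r => Xn1.
have szr : size r = n.
  by apply: succn_inj; rewrite -(@size_XnsubC F n 1 n0) polyC1 Xn1 size_prod_XsubC.
have /hasP[z _ primz] : has n.-primitive_root r; last by exists z.
apply: has_prim_root; rewrite ?szr //.
  by apply/allP => z zr; rewrite /root_of_unity Xn1 root_prod_XsubC.
by rewrite -separable_prod_XsubC -Xn1 separable_Xn_sub_1.
Qed.

Lemma real_root_of_unity (R : realDomainType) (x : R) (N : nat) : (0 < N)%N ->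
  x ^+ N = 1 <-> x = 1 \/ (x = -1 /\ ~~ odd N).
Proof.
move=> N0; split=> [xN | [->|[-> /negbTE oN]]]; last 2 first.
- by rewrite expr1n.
- by rewrite -signr_odd oN.
have : `|x| == 1 by rewrite -(pexpr_eq1 N0) // -normrX xN normr1.
rewrite eqr_norml ler01 andbT => /orP[/eqP|/eqP xN1]; [by left | right].
move: xN; rewrite xN1 -signr_odd; case: odd => //= /eqP.
by rewrite lt_eqF // (lt_trans _ ltr01) // oppr_lt0.
Qed.

(** * The real and complex transformations *)

Lemma rpoint_inj (R : realType) (p q : rpoint R) :
  rx p = rx q -> rt p = rt q -> ru p = ru q -> rv p = rv q -> p = q.
Proof.
case: p q => [x t u v x0 u0] [y s w z y0 w0] /= xy ts uw vz; subst.
by rewrite (bool_irrelevance x0 y0) (bool_irrelevance u0 w0).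
Qed.

Lemma real_log_chart (R : realType) (eps : R) (eps_neq0 : eps != 0) :
  log_chart expR eps (rtransf eps_neq0) (fun p => ln (rx p)) (@rt R) (@ru R)
    (@rv R).
Proof.
have rxE p : expR (ln (rx p)) = rx p by apply: lnK; exact: rx_gt0.
split=> //=; [exact: expR0 | exact: expRD | exact: ru_neq0 | | | | ].
- by move=> p; rewrite expRK.
- by move=> p; rewrite rxE.
- by move=> p q lpq; apply: rpoint_inj; rewrite -rxE lpq rxE.
- move=> a b c; exists (RPoint b c (expR_gt0 a) (oner_neq0 R)).
  by rewrite /= expRK.
Qed.

Lemma cexp0 (R : realType) : cexp (0 : R[i]) = 1.
Proof. by rewrite /cexp /= expR0 cos0 sin0 mul1r. Qed.

Lemma cexpD (R : realType) (a b : R[i]) : cexp (a + b) = cexp a * cexp b.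
Proof.
case: a b => [a a'] [b b']; rewrite /cexp /= expRD cosD sinD.
by apply/eqP; rewrite eq_complex /=; apply/andP; split; apply/eqP; ring.
Qed.

Lemma logsurf_inj (R : realType) : injective (@lln R).
Proof.
move=> [x a xa] [y b yb] /= ab; subst b.
have xy : x = y by rewrite (eqP xa) (eqP yb).
by subst y; rewrite (bool_irrelevance xa yb).
Qed.

Lemma cpoint_inj (R : realType) (p q : cpoint R) :
    lln (cx p) = lln (cx q) -> ct p = ct q -> cu p = cu q -> cv p = cv q ->
  p = q.
Proof.
case: p q => [x t u v u0] [y s w z w0] /= /logsurf_inj xy ts uw vz; subst.
by rewrite (bool_irrelevance u0 w0).
Qed.

Lemma complex_log_chart (R : realType) (eps : R[i]) (eps_neq0 : eps != 0) :
  log_chart (@cexp R) eps (ctransf eps_neq0) (fun p => lln (cx p)) (@ct R)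
    (@cu R) (@cv R).
Proof.
split=> //=; [exact: cexp0 | exact: cexpD | exact: cu_neq0 | | | ].
- by move=> p; rewrite -(eqP (lvalE (cx p))).
- exact: cpoint_inj.
- by move=> a b c; exists (CPoint (lexp a) b c (oner_neq0 R[i])).
Qed.

Theorem mainTheorem10 (R : realType) :
  (* real variables, real eps *)
  (forall (eps : R) (eps_neq0 : eps != 0),
    let T := rtransf eps_neq0 in
    [/\ (* the 2N-th iterate *)
        forall (N : nat) (p : rpoint R), (0 < N)%N ->
          let q := iter (2 * N)%N T p in
          [/\ rx q = rx p `^ (eps ^+ N),
              rt q = rt p,
              ru q = ru p * rx p `^ (2 * (1 - eps ^+ N))
            & rv q = eps ^+ N * rv p + 2 * (eps ^+ N - 1) * rt p],
        (* roots of eps ^ N = 1; the order is exactly 2N when N is least *)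
        forall N : nat, (0 < N)%N -> eps ^+ N = 1 ->
          iter (2 * N)%N T =1 id /\
          exists2 m : nat, (m %| 2 * N)%N & forms_cyclic_group T m,
        forall N : nat, N.-primitive_root eps ->
          forms_cyclic_group T (2 * N)%N,
        (* the only real roots *)
        forall N : nat, (0 < N)%N ->
          eps ^+ N = 1 <-> eps = 1 \/ (eps = -1 /\ ~~ odd N)
      & (eps = 1 -> forms_cyclic_group T 2) /\
        (eps = -1 -> forms_cyclic_group T 4)]) /\
  (* complex variables, complex eps *)
  (forall (eps : R[i]) (eps_neq0 : eps != 0),
    let T := ctransf eps_neq0 in
    [/\ forall (N : nat) (p : cpoint R), (0 < N)%N ->
          let q := iter (2 * N)%N T p in
          [/\ cx q = lpow (cx p) (eps ^+ N),
              ct q = ct p,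
              cu q = cu p * lval (lpow (cx p) (2 * (1 - eps ^+ N)))
            & cv q = eps ^+ N * cv p + 2 * (eps ^+ N - 1) * ct p],
        forall N : nat, (0 < N)%N -> eps ^+ N = 1 ->
          iter (2 * N)%N T =1 id /\
          exists2 m : nat, (m %| 2 * N)%N & forms_cyclic_group T m,
        forall N : nat, N.-primitive_root eps ->
          forms_cyclic_group T (2 * N)%N
      & (eps = 1 -> forms_cyclic_group T 2) /\
        (eps = -1 -> forms_cyclic_group T 4)]) /\
  (* cyclic groups of any even order *)
  (forall N : nat, (0 < N)%N ->
    exists (eps : R[i]) (eps_neq0 : eps != 0),
      forms_cyclic_group (ctransf eps_neq0) (2 * N)%N) /\
  (* eps = i *)
  (let T := ctransf (i_neq0 R) in
    (forall p : cpoint R,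
      [/\ cx (T p) = lexp (ct p + cv p / 2),
          ct (T p) = ct p,
          cu (T p) =
            4 * 'i%C / (cu p * lval (cx p) ^+ 2 * cexp (cv p + 2 * ct p))
        & cv (T p) = 2 * ('i%C * lln (cx p) - ct p)]) /\
    forms_cyclic_group T 8).
Proof.
have powE (x a : R) : 0 < x -> x `^ a = expR (a * ln x).
  by move=> x0; rewrite /powR gt_eqF.
split; [|split; [|split]].
- move=> eps eps_neq0 T; have chart := real_log_chart eps_neq0.
  have cyc N := @chart_cyclic_prim _ _ _ _ _ _ _ _ _ chart eps_neq0 N.
  split.
  + move=> N p N0 q; have [lq tq uq vq] := chart_iter_even chart eps_neq0 N p.
    split=> //; rewrite powE ?rx_gt0 //.
    by rewrite -lq lnK //; exact: rx_gt0.
  + by move=> N; apply: (chart_cyclic_dvdn chart).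
  + exact: cyc.
  + by move=> N; apply: real_root_of_unity.
  + split=> e1.
      by apply: (cyc 1%N); rewrite e1; exact: prim_root1.
    by apply: (cyc 2%N); rewrite e1; exact: prim_rootN1.
- move=> eps eps_neq0 T; have chart := complex_log_chart eps_neq0.
  have cyc N := @chart_cyclic_prim _ _ _ _ _ _ _ _ _ chart eps_neq0 N.
  split.
  + move=> N p N0 q; have [lq tq uq vq] := chart_iter_even chart eps_neq0 N p.
    by split=> //; apply: logsurf_inj; rewrite /= -lq.
  + by move=> N; apply: (chart_cyclic_dvdn chart).
  + exact: cyc.
  + split=> e1.
      by apply: (cyc 1%N); rewrite e1; exact: prim_root1.
    by apply: (cyc 2%N); rewrite e1; exact: prim_rootN1.
- move=> N N0.
  have [|eps primN] := @closed_field_prim_root R[i] N.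
    by rewrite pnatr_eq0 -lt0n.
  have eps_neq0 : eps != 0 by rewrite (prim_root_eq0 primN) -lt0n.
  exists eps, eps_neq0.
  exact: (chart_cyclic_prim (complex_log_chart eps_neq0) eps_neq0).
- move=> T; have chart := complex_log_chart (i_neq0 R); split.
    move=> p; split=> //.
    rewrite /T /= /cnew_u (chart_expN chart).
    by rewrite [in RHS]invfM !mulrA -!mulrA; congr (_ * (_ * _)); rewrite mulrC.
  have cyc N := @chart_cyclic_prim _ _ _ _ _ _ _ _ _ chart (i_neq0 R) N.
  exact: (cyc 4%N (prim_root_imaginary R)).
Qed.
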